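(* Let $N$ be a $2n$-dimensional smooth manifold with an almost complex structure $J$ and a linear connection $\nabla$ with torsion tensor $T^{\nabla}$. If $d^{\nabla}J=0$ and $T^{\nabla}(JX,Y)=-T^{\nabla}(X,JY)$ for all vector fields $X,Y$ on $N$ (the torsion-compatibility condition), then $J$ is integrable.
   Context: An almost complex structure is a $(1,1)$-tensor field $J$ with $J^2=-\mathrm{id}$. $T^{\nabla}(X,Y)=\nabla_XY-\nabla_YX-[X,Y]$, $(\nabla_XJ)Y=\nabla_X(JY)-J\nabla_XY$, and $(d^{\nabla}J)(X,Y)=(\nabla_XJ)Y-(\nabla_YJ)X+J\,T^{\nabla}(X,Y)$. $J$ is integrable if its Nijenhuis tensor $N_J(X,Y)=-J^2[X,Y]+J[X,JY]+J[JX,Y]-[JX,JY]$ vanishes identically. *)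

(* Defs.v *)
From HB Require Import structures.
From mathcomp Require Import all_boot all_order all_algebra.
From mathcomp Require Import all_classical all_reals all_analysis.
From mathcomp Require Import ring.

Set Implicit Arguments.
Unset Strict Implicit.
Unset Printing Implicit Defensive.

Import Order.TTheory GRing.Theory Num.Theory.
Import numFieldNormedType.Exports.

Local Open Scope classical_set_scope.
Local Open Scope ring_scope.

Section smooth_on.
Variables (R : realType) (m : nat).
Implicit Types (U : set 'rV[R]_m) (f g : 'rV[R]_m -> R) (k : nat).

(* Only meant for [U] open. *)
Fixpoint Ck k U f : Prop :=
  (forall x, U x -> {for x, continuous f}) /\
  if k is k'.+1 then
    forall i : 'I_m, (forall x, U x -> derivable f x (delta_mx 0 i)) /\
                     Ck k' U ('D_(delta_mx 0 i) f)
  else True.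

Definition smooth_on U f := forall k, Ck k U f.

Lemma Ck_eq k U f g : open U -> (forall x, U x -> f x = g x) ->
  Ck k U f -> Ck k U g.
Proof.
move=> oU; have nearU (h1 h2 : 'rV[R]_m -> R) x : (forall y, U y -> h1 y = h2 y) -> U x ->
    \forall y \near x, h1 y = h2 y.
  by move=> h12 Ux; near=> y; apply: h12; near: y; apply: open_nbhs_nbhs.
have cont (h1 h2 : 'rV[R]_m -> R) x : (forall y, U y -> h1 y = h2 y) -> U x ->
    {for x, continuous h1} -> {for x, continuous h2}.
  move=> h12 Ux; rewrite /prop_for /continuous_at -(h12 _ Ux) => ch1.
  apply: cvg_trans ch1; apply: (@near_eq_cvg _ _ (nbhs x)); exact: nearU.
elim: k f g => [|k IH] f g fg [cf Df];
  (split; first by move=> x Ux; exact: cont fg Ux (cf x Ux)) => //.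
move=> i; have [df Di] := Df i; split=> [x Ux|].
  by apply: near_eq_derivable (df x Ux); apply: nearU.
by apply: IH Di => x Ux; apply: near_eq_derive; apply: nearU.
Unshelve. all: by end_near. Qed.

Lemma CkW k U f : Ck k.+1 U f -> Ck k U f.
Proof.
elim: k f => [|k IH] f [cf Df]; split=> // i.
by have [df Di] := Df i; split=> //; apply: IH.
Qed.

Lemma Ck_cst k U a : open U -> Ck k U (cst a).
Proof.
move=> oU; elim: k a => [|k IH] a;
  (split; first by move=> x _; exact: cst_continuous) => //.
move=> i; split=> [x _|]; first exact: derivable_cst.
by apply: (Ck_eq oU _ (IH 0)) => x _; rewrite derive_cst.
Qed.

Lemma CkD k U f g : open U -> Ck k U f -> Ck k U g -> Ck k U (f + g).
Proof.
move=> oU; elim: k f g => [|k IH] f g [cf Df] [cg Dg];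
  (split; first by move=> x Ux; apply: continuousD; [exact: cf|exact: cg]) => //.
move=> i; have [[df Df'] [dg Dg']] := (Df i, Dg i); split=> [x Ux|].
  by apply: derivableD; [exact: df|exact: dg].
apply: (Ck_eq oU _ (IH _ _ Df' Dg')) => x Ux.
by rewrite deriveD//; [exact: df|exact: dg].
Qed.

Lemma CkM k U f g : open U -> Ck k U f -> Ck k U g -> Ck k U (f * g).
Proof.
move=> oU; elim: k f g => [|k IH] f g Hf Hg; have [cf Df] := Hf;
  have [cg Dg] := Hg;
  (split; first by move=> x Ux; apply: continuousM; [exact: cf|exact: cg]) => //.
move=> i; have [[df Df'] [dg Dg']] := (Df i, Dg i); split=> [x Ux|].
  by apply: derivableM; [exact: df|exact: dg].
apply: (Ck_eq oU _ (CkD oU (IH _ _ (CkW Hf) Dg') (IH _ _ (CkW Hg) Df'))) => x Ux.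
by rewrite deriveM//; [exact: df|exact: dg].
Qed.

End smooth_on.

Section charts.
Variables (R : realType) (M : topologicalType) (m : nat).

(* [cinv] is total; its values outside [ccod] are irrelevant. *)
Record chart := Chart {
  cdom : set M ;
  ccod : set 'rV[R]_m ;
  cmap : M -> 'rV[R]_m ;
  cinv : 'rV[R]_m -> M ;
  cdom_open : open cdom ;
  ccod_open : open ccod ;
  cmap_cod : forall p, cdom p -> ccod (cmap p) ;
  cinv_dom : forall x, ccod x -> cdom (cinv x) ;
  cmapK : forall p, cdom p -> cinv (cmap p) = p ;
  cinvK : forall x, ccod x -> cmap (cinv x) = x ;
  cmap_continuous : forall p, cdom p -> {for p, continuous cmap} ;
  cinv_continuous : forall x, ccod x -> {for x, continuous cinv} }.

Definition smooth_transition (c d : chart) := forall i : 'I_m,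
  smooth_on (ccod c `&` cinv c @^-1` cdom d) (fun x => cmap d (cinv c x) 0 i).

End charts.

(* The atlas need not be maximal: it is contained in a unique maximal one, with
   the same smooth functions. *)
Record smoothManifold (R : realType) (m : nat) := SmoothManifold {
  manifold_sort :> topologicalType ;
  manifold_hausdorff : hausdorff_space manifold_sort ;
  manifold_second_countable : @second_countable manifold_sort ;
  atlas : set (chart R manifold_sort m) ;
  atlas_cover : forall p : manifold_sort, exists2 c, atlas c & cdom c p ;
  atlas_compatible : forall c d, atlas c -> atlas d -> smooth_transition c d }.

Section smooth_functions.
Variables (R : realType) (m : nat) (N : smoothManifold R m).

Definition is_smooth : set (N -> R) :=
  [set f : N -> R | forall c, atlas c -> smooth_on (ccod c) (f \o cinv c)].

Record smooth_fun := SmoothFun {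
  smooth_val :> N -> R ;
  smooth_valP : smooth_val \in is_smooth }.

HB.instance Definition _ := [isSub for smooth_val].
HB.instance Definition _ := [Choice of smooth_fun by <:].

Lemma is_smooth_cst (a : R) : is_smooth (cst a).
Proof. by move=> c _ k; apply: Ck_cst; exact: ccod_open. Qed.

Lemma is_smoothD f g : is_smooth f -> is_smooth g -> is_smooth (f + g).
Proof.
move=> sf sg c ac k; apply: (@CkD _ _ k _ (f \o cinv c) (g \o cinv c)).
- exact: ccod_open.
- exact: sf.
- exact: sg.
Qed.

Lemma is_smoothM f g : is_smooth f -> is_smooth g -> is_smooth (f * g).
Proof.
move=> sf sg c ac k; apply: (@CkM _ _ k _ (f \o cinv c) (g \o cinv c)).
- exact: ccod_open.
- exact: sf.
- exact: sg.
Qed.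

Lemma is_smooth_subring : subring_closed (mem is_smooth).
Proof.
split=> [|f g|f g]; rewrite !inE; first exact: is_smooth_cst.
  move=> sf sg; apply: is_smoothD => //.
  rewrite -mulN1r; apply: is_smoothM => //.
  exact: (is_smooth_cst (-1)).
exact: is_smoothM.
Qed.

HB.instance Definition _ :=
  GRing.SubChoice_isSubComPzRing.Build (N -> R) _ smooth_fun is_smooth_subring.

Lemma is_smooth_submod : subsemimod_closed (mem is_smooth : {pred N -> R}).
Proof.
split; first split=> [|f g]; rewrite ?inE.
- exact: (is_smooth_cst 0).
- exact: is_smoothD.
- move=> a f; rewrite !inE => sf.
  exact: is_smoothM (is_smooth_cst a) sf.
Qed.

HB.instance Definition _ :=
  GRing.SubZmodule_isSubLmodule.Build R (N -> R) _ smooth_fun is_smooth_submod.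

Lemma smooth_funP (f g : smooth_fun) : (forall p, f p = g p) -> f = g.
Proof. by move=> fg; apply: val_inj; apply/funext. Qed.

End smooth_functions.

Section tangent_space.
Variables (R : realType) (m : nat) (N : smoothManifold R m) (p : N).

(* Tangent vectors at [p] are the derivations at [p] of the algebra of smooth
   functions. *)
Definition is_derivation_at : set (smooth_fun N -> R) :=
  [set v | (forall (a : R) (f g : smooth_fun N), v (a *: f + g) = a * v f + v g) /\
           (forall f g : smooth_fun N, v (f * g) = f p * v g + g p * v f)].

Record tangent := Tangent {
  tangent_val :> smooth_fun N -> R ;
  tangent_valP : tangent_val \in is_derivation_at }.

HB.instance Definition _ := [isSub for tangent_val].
HB.instance Definition _ := [Choice of tangent by <:].

Lemma is_derivation_at_submod :
  subsemimod_closed (mem is_derivation_at : {pred smooth_fun N -> R}).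
Proof.
split; first split=> [|u v]; rewrite ?inE.
- have E h : (0 : smooth_fun N -> R) h = 0 by [].
  by split=> *; rewrite !E !mulr0 addr0.
- move=> [u1 u2] [v1 v2]; have E h : (u + v) h = u h + v h by [].
  by split=> *; rewrite !E ?u1 ?v1 ?u2 ?v2 !mulrDr addrACA.
- move=> a u; rewrite !inE => -[u1 u2].
  have E h : (a *: u) h = a * u h by [].
  by split=> *; rewrite !E ?u1 ?u2 !mulrDr ?[a * (_ * _)]mulrCA.
Qed.

HB.instance Definition _ := GRing.SubChoice_isSubLmodule.Build
  R (smooth_fun N -> R) _ tangent is_derivation_at_submod.

Lemma tangentP (u v : tangent) : (forall f, u f = v f) -> u = v.
Proof. by move=> uv; apply: val_inj; apply/funext. Qed.

End tangent_space.

Section vector_fields.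
Variables (R : realType) (m : nat) (N : smoothManifold R m).

Definition is_smooth_field (X : forall p : N, tangent p) :=
  forall f : smooth_fun N, is_smooth (fun p => X p f).

Record vfield := VField {
  vfield_val :> forall p : N, tangent p ;
  vfield_valP : is_smooth_field vfield_val }.

Lemma vfieldP (X Y : vfield) : (forall p, X p = Y p) -> X = Y.
Proof.
case: X Y => [X sX] [Y sY] /= XY; have {}XY := functional_extensionality_dep XY.
by case: _ / XY sY => sY; congr VField; exact: Prop_irrelevance.
Qed.

HB.instance Definition _ := gen_eqMixin vfield.
HB.instance Definition _ := gen_choiceMixin vfield.

Definition vfield0 : vfield.
Proof.
by exists (fun p => 0) => f; exact: (is_smooth_cst 0).
Defined.

Definition vfield_add (X Y : vfield) : vfield.
Proof.
exists (fun p => X p + Y p) => f.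
exact: is_smoothD (vfield_valP X f) (vfield_valP Y f).
Defined.

Definition vfield_scale (h : smooth_fun N) (X : vfield) : vfield.
Proof.
exists (fun p => h p *: X p) => f.
by apply: is_smoothM (vfield_valP X f); rewrite -inE; exact: smooth_valP.
Defined.

Definition vfield_opp (X : vfield) : vfield := vfield_scale (-1) X.

Let addA : associative vfield_add.
Proof. by move=> X Y Z; apply: vfieldP => p; exact: addrA. Qed.
Let addC : commutative vfield_add.
Proof. by move=> X Y; apply: vfieldP => p; exact: addrC. Qed.
Let add0 : left_id vfield0 vfield_add.
Proof. by move=> X; apply: vfieldP => p; exact: add0r. Qed.
Let addN : left_inverse vfield0 vfield_opp vfield_add.
Proof. by move=> X; apply: vfieldP => p /=; rewrite scaleN1r addNr. Qed.

HB.instance Definition _ := GRing.isZmodule.Build vfield addA addC add0 addN.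

Let scaleA h k X : vfield_scale h (vfield_scale k X) = vfield_scale (h * k) X.
Proof. by apply: vfieldP => p; exact: scalerA. Qed.
Let scale1 : left_id 1 vfield_scale.
Proof. by move=> X; apply: vfieldP => p; exact: scale1r. Qed.
Let scaleDr : right_distributive vfield_scale +%R.
Proof. by move=> h X Y; apply: vfieldP => p; exact: scalerDr. Qed.
Let scaleDl X : {morph vfield_scale^~ X : h k / h + k}.
Proof. by move=> h k; apply: vfieldP => p; exact: scalerDl. Qed.

HB.instance Definition _ :=
  GRing.Zmodule_isLmodule.Build (smooth_fun N) vfield scaleA scale1 scaleDr scaleDl.

Definition vfield_act (X : vfield) (f : smooth_fun N) : smooth_fun N :=
  SmoothFun (mem_set (vfield_valP X f)).

Lemma lie_subproof (X Y : vfield) (p : N) :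
  (fun f => X p (vfield_act Y f) - Y p (vfield_act X f)) \in is_derivation_at p.
Proof.
have der (Z : vfield) q : is_derivation_at q (Z q).
  by apply: set_mem; exact: tangent_valP.
have actL (Z : vfield) (a : R) f g :
    vfield_act Z (a *: f + g) = a *: vfield_act Z f + vfield_act Z g.
  by apply: smooth_funP => q; exact: (der Z q).1.
have actM (Z : vfield) f g :
    vfield_act Z (f * g) = f * vfield_act Z g + g * vfield_act Z f.
  by apply: smooth_funP => q; exact: (der Z q).2.
have tD (Z : vfield) q f g : Z q (f + g) = Z q f + Z q g.
  by rewrite -[f]scale1r (der Z q).1 mul1r scale1r.
rewrite inE; split=> [a f g|f g].
  by rewrite !actL !(der _ _).1 mulrBr opprD addrACA.
rewrite !actM !tD !(der _ _).2 /=; ring.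
Qed.

Definition lie (X Y : vfield) : vfield.
Proof.
exists (fun p => Tangent (lie_subproof X Y p)) => f.
have /set_mem// := smooth_valP
  (vfield_act X (vfield_act Y f) - vfield_act Y (vfield_act X f)).
Defined.

End vector_fields.

Section tensors_and_connections.
Variables (R : realType) (m : nat) (N : smoothManifold R m).
Implicit Types X Y Z : vfield N.

(* A (1,1)-tensor field, as a smooth field of endomorphisms of the tangent
   spaces. *)
Record tensor11 := Tensor11 {
  tensor11_val :> forall p : N, {linear tangent p -> tangent p} ;
  tensor11_smooth : forall X, is_smooth_field (fun p => tensor11_val p (X p)) }.

Definition tensor11_app (J : tensor11) X : vfield N :=
  VField (tensor11_smooth J X).

Definition almost_complex (J : tensor11) :=
  forall (p : N) (v : tangent p), J p (J p v) = - v.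

(* Linearity over the reals in the second argument follows from additivity and
   the Leibniz rule for constant functions. *)
Record connection := Connection {
  nabla :> vfield N -> vfield N -> vfield N ;
  nablaDl : forall X Y Z, nabla (X + Y) Z = nabla X Z + nabla Y Z ;
  nablaZl : forall f X Y, nabla (f *: X) Y = f *: nabla X Y ;
  nablaDr : forall X Y Z, nabla X (Y + Z) = nabla X Y + nabla X Z ;
  nablaZr : forall X f Y, nabla X (f *: Y) = vfield_act X f *: Y + f *: nabla X Y }.

Variables (D : connection) (J : tensor11).
Local Notation j := (tensor11_app J).

Definition torsion X Y := D X Y - D Y X - lie X Y.

Definition nabla_tensor X Y := D X (j Y) - j (D X Y).

Definition d_nabla X Y := nabla_tensor X Y - nabla_tensor Y X + j (torsion X Y).

Definition nijenhuis X Y :=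
  - j (j (lie X Y)) + j (lie X (j Y)) + j (lie (j X) Y) - lie (j X) (j Y).

Definition is_integrable := forall X Y, nijenhuis X Y = 0.

End tensors_and_connections.

(* Main.v *)
Require Import Defs.
From mathcomp Require Import all_boot all_order all_algebra.
From mathcomp Require Import all_classical all_reals all_analysis.
Import GRing.Theory.
Local Open Scope ring_scope.

(** Expanding the torsion in [d_nabla] leaves
    [d_nabla X Y = nabla X (J Y) - nabla Y (J X) - J [X, Y]], so [d_nabla = 0]
    says [J [X, Y] = nabla X (J Y) - nabla Y (J X)]. Substituting this in the
    middle terms of the Nijenhuis tensor gives [N_J X Y = T (J X) (J Y) - T X Y],
    which vanishes since [T (J X) (J Y) = - T X (J (J Y)) = T X Y]. *)

Section tensors_and_connections.
Context {R : realType} {m : nat} {N : smoothManifold R m}.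
Variables (D : connection N) (J : tensor11 N).
Implicit Types X Y : vfield N.
Local Notation j := (tensor11_app J).
Local Notation T := (torsion D).

Lemma tensor11_appD X Y : j (X + Y) = j X + j Y.
Proof. by apply: vfieldP => p; exact: linearD. Qed.

Lemma tensor11_appN X : j (- X) = - j X.
(* Opposite fields are defined as multiples by the function [-1], hence [scaleN1r] at each point. *)
Proof. by apply: vfieldP => p /=; rewrite !scaleN1r linearN. Qed.

Lemma tensor11_appK : almost_complex J -> forall X, j (j X) = - X.
Proof. by move=> HJ X; apply: vfieldP => p /=; rewrite HJ scaleN1r. Qed.

(** Additivity alone gives this; the Leibniz rule would require differentiating the constant
    [-1]. *)
Lemma nablaNr X Y : D X (- Y) = - D X Y.
Proof.
have D0 : D X 0 = 0 by apply: (addrI (D X 0)); rewrite -nablaDr !addr0.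
by apply: (addrI (D X Y)); rewrite -nablaDr !subrr.
Qed.

Lemma torsionNr X Y : T X (- Y) = - T X Y.
Proof.
have lieN : lie X (- Y) = - lie X Y.
  apply: vfieldP => p; apply: tangentP => f.
  have actN : vfield_act (- Y) f = - vfield_act Y f.
    by apply: smooth_funP => q /=; rewrite scaleN1r.
  have XN g : X p (- g) = - X p g.
    have [XL _] := set_mem (tangent_valP (X p)).
    (* Linearity of a derivation is stated on [a *: f + g]; it is taken here at [a = 1],
       [f = g = 0]. *)
    have X0 : X p 0 = 0.
      by apply: (addrI (X p 0)); rewrite -{1}[X p 0]mul1r -XL scaler0 !addr0.
    by rewrite -[- g]addr0 -scaleN1r XL X0 mulN1r addr0.
  by rewrite /= actN XN !scaleN1r -opprD.
have nablaNl : D (- Y) X = - D Y X by rewrite -[- Y]scaleN1r nablaZl scaleN1r.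
by rewrite /torsion nablaNr nablaNl lieN -!opprD.
Qed.

(** The terms [j (D X Y)] and [j (D Y X)] cancel against those coming from [j (T X Y)]. *)
Lemma d_nablaE X Y : d_nabla D J X Y = D X (j Y) - D Y (j X) - j (lie X Y).
Proof.
rewrite /d_nabla /nabla_tensor /torsion !tensor11_appD !tensor11_appN.
by rewrite opprB addrA; congr (_ - _); rewrite addrAC !subrKA.
Qed.

Lemma nijenhuis_torsion : almost_complex J ->
    (forall X Y, d_nabla D J X Y = 0) ->
  forall X Y, nijenhuis J X Y = T (j X) (j Y) - T X Y.
Proof.
move=> HJ Hd X Y; have jK := tensor11_appK HJ.
have jlie U V : j (lie U V) = D U (j V) - D V (j U).
  by apply/esym/eqP; rewrite -subr_eq0 -d_nablaE Hd.
(* The middle terms become [- D X Y - D (j Y) (j X)] and [D (j X) (j Y) + D Y X]; the rest is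
   reordering. *)
rewrite /nijenhuis jK opprK !jlie !jK !nablaNr opprK /torsion.
rewrite [RHS]addrAC; congr (_ - _); rewrite !opprB -addrA [RHS]addrCA; congr (_ + _).
by rewrite addrC [- D X Y - _]addrC addrACA.
Qed.

End tensors_and_connections.

Theorem proposition2 (R : realType) (n : nat) (N : smoothManifold R (2 * n)%N)
    (J : tensor11 N) (nabla : connection N)
    (HJ : almost_complex J)
    (Hd : forall X Y : vfield N, d_nabla nabla J X Y = 0)
    (HT : forall X Y : vfield N,
        torsion nabla (tensor11_app J X) Y = - torsion nabla X (tensor11_app J Y)) :
  is_integrable J.
Proof.
move=> X Y; rewrite (nijenhuis_torsion _ _ HJ Hd) HT (tensor11_appK _ HJ).
by rewrite torsionNr opprK subrr.
Qed.
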